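(* Let $G$ be a finite abelian group of type $(m_1,\ldots,m_r)$, that is, $G\cong\mathbb{Z}_{m_1}\oplus\dotsb\oplus\mathbb{Z}_{m_r}$ with integers $1\neq m_1\mid m_2\mid\dotsb\mid m_r$ (and $r\ge 0$). Then $$\operatorname{diam}(G)=\sum_{i=1}^r\lfloor m_i/2\rfloor.$$
   Context: Here $\mathbb{Z}_n=\mathbb{Z}/n\mathbb{Z}$; the trivial group has type $()$ with $r=0$. For a subset $A$ of a finite abelian group $G$ (written additively) put $A^\pm:=(-A)\cup\{0\}\cup A$, and for an integer $\rho\ge 0$ let $\langle A\rangle_\rho:=\{a_1+\dotsb+a_\rho: a_i\in A^\pm\}$ (with $\langle A\rangle_0=\{0\}$). The diameter of $G$ with respect to $A$ is $\operatorname{diam}_A(G):=\min\{\rho\ge 0:\langle A\rangle_\rho=G\}$, with $\min\varnothing=\infty$; thus $\operatorname{diam}_A(G)<\infty$ iff $A$ generates $G$. The absolute diameter is $\operatorname{diam}(G):=\max\{\operatorname{diam}_A(G): A\subseteq G,\ \langle A\rangle=G\}$. *)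

(* Defs.v *)
From HB Require Import structures.
From mathcomp Require Import all_boot all_order all_algebra all_fingroup.
From mathcomp Require Import boolp.
Set Implicit Arguments.
Unset Strict Implicit.
Unset Printing Implicit Defensive.
Import GRing.Theory.
Local Open Scope ring_scope.

(* The sum of the 'Z_(m_i) is their external direct product; the group law of
   a finZmodType, seen as a finGroupType, is its addition. As 'Z_0 and 'Z_1
   are not Z/0 and Z/1, the bound 1 < m_i is required of every i; for the
   nonzero m_i it amounts to m_1 != 1 along a divisibility chain. *)
Definition has_type (G : finZmodType) (r : nat) (m : r.-tuple nat) : Prop :=
  [/\ forall i, (1 < tnth m i)%N,
      sorted dvdn m
    & [set: G] \isog [set: {dffun forall i : 'I_r, 'Z_(tnth m i)}]].

Section Diameter.
Variable G : finZmodType.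
Implicit Types A : {set G}.

Definition sym0 A : {set G} := [set - a | a in A] :|: [set 0] :|: A.

Definition ball A (rho : nat) : {set G} :=
  [set \sum_(i < rho) (a : {ffun 'I_rho -> G}) i | a in ffun_on (mem (sym0 A))].

Definition covers A : pred nat := fun rho => ball A rho == [set: G].

(* Values in nat extended by an infinity, encoded as None. *)
Definition diam_wrt A : option nat :=
  if pselect (exists rho, covers A rho) is left h then Some (ex_minn h)
  else None.

Definition omax (x y : option nat) : option nat :=
  if x is Some m then (if y is Some n then Some (maxn m n) else None) else None.

(* The neutral element Some 0 is the least value, so it does not affect the
   maximum, whose range is nonempty (it contains A = G). *)
Definition diam : option nat :=
  \big[omax/Some 0%N]_(A : {set G} | <<A>>%g == [set: G]) diam_wrt A.

End Diameter.

(* Main.v *)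
Require Import Defs.
From HB Require Import structures.
From mathcomp Require Import all_boot all_order all_algebra all_fingroup.
From mathcomp Require Import all_solvable zify.
Set Implicit Arguments.
Unset Strict Implicit.
Unset Printing Implicit Defensive.

(** The diameter with respect to a generating set A is bounded by adding the
    elements of A one at a time. If K = <a> + H has index n over H, every
    element of K is a multiple j a with |j| <= n/2 plus an element of H, so
    the radius needed for K exceeds the one needed for H by at most
    floor(n/2) ([joing_cycle_index]). It remains to see that the sum of the
    floor(m_i/2) over the type of the group grows by at least floor(n/2) when
    H is replaced by K ([leq_halves_index]).

    List the invariant factors in decreasing order, k_0, k_1, ... for K and
    h_0, h_1, ... for H. They interlace: h_i divides k_i and k_(i+1) divides
    h_i. This follows from a description of the invariant factors that involves
    no choice of a basis: k_i divides d iff the subgroup d K has rank at most i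
    ([rank_power_subgroup]); and the rank of d H is that of d K or one less.
    Since n is the product of the quotients k_i / h_i, what is left is an
    inequality between integers, which without the floors is the telescoping
    estimate
      sum (k_i - h_i) = sum h_i (k_i / h_i - 1) >= prod (k_i / h_i) - 1,
    where each h_i is bounded below by the product of the later quotients
    ([interlaced_halves]). The floors are harmless because x |-> floor(c x / 2)
    - floor(x / 2) is still nondecreasing for a positive integer c
    ([leq_half_mul]).

    The bound is attained by the images of the unit vectors of the product of
    the Z/m_i: the sum over i of the distances from the i-th coordinate to 0
    around the cycle Z/m_i grows by at most one with each summand +-a, and it
    is the sum of the floor(m_i/2) at the point whose coordinates are the
    floor(m_i/2) ([product_norm_antipode]). *)

(** * Interlacing sequences of integers *)

(** The increments of x |-> floor(k x / 2) dominate those of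
    x |-> floor(x / 2): the latter is 1 only when x passes from odd to even,
    and then the former is k - floor(k / 2). *)
Lemma leq_half_mul k x y :
  0 < k -> x <= y -> (k * x) %/ 2 + y %/ 2 <= x %/ 2 + (k * y) %/ 2.
Proof.
move=> k_gt0 lexy; rewrite -(subnKC lexy); elim: (y - x) => [|d]; first by lia.
rewrite addnS; move: (x + d) => z.
have [t [->|->]] : exists t, z = t.*2 \/ z = t.*2.+1.
  by exists z./2; have := odd_double_half z; case: (odd z); lia.
  have -> : k * t.*2 = (k * t).*2 by lia.
  have -> : k * t.*2.+1 = (k * t).*2 + k by lia.
  by lia.
have -> : k * t.*2.+1 = (k * t).*2 + k by lia.
have -> : k * t.*2.+2 = (k * t).*2 + k.*2 by lia.
by lia.
Qed.

(** The inequality behind the upper bound. The bound of the product by k 0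
    makes the induction work: applied to the shifted sequences it shows that
    the product of the later quotients is at most h 0, which is what
    [leq_half_mul] requires of the two numbers multiplied by k 0 / h 0. *)
Lemma interlaced_halves N (h k : nat -> nat) :
    (forall i, 0 < k i) -> (forall i, h i %| k i) ->
    (forall i, k i.+1 <= h i) ->
  let q := \prod_(0 <= i < N) (k i %/ h i) in
  q <= k 0 /\
  q %/ 2 + \sum_(0 <= i < N) h i %/ 2 <= \sum_(0 <= i < N) k i %/ 2.
Proof.
elim: N h k => [|N IHN] h k k_gt0 hk kh /=.
  by rewrite !big_geq.
rewrite !big_nat_recl //=.
have [] := IHN (h \o succn) (k \o succn); try by move=> i /=.
rewrite /=; set q := \prod_(0 <= i < N) _ => leq_q leq_s.
have le_qh : q <= h 0 by apply: leq_trans leq_q (kh 0).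
have /dvdnP[c ec] := hk 0.
have h_gt0 : 0 < h 0 by apply: dvdn_gt0 (hk 0).
rewrite ec mulnK //; split; first by rewrite leq_mul2l le_qh orbT.
have c_gt0 : 0 < c by have := k_gt0 0; rewrite ec; case: (c).
by have := leq_half_mul c_gt0 le_qh; lia.
Qed.

(** * Invariant factors of subgroups with a cyclic quotient *)

Section Power.
Import GroupScope.
Variable gT : finGroupType.
Implicit Types (G H K : {group gT}) (x a : gT) (b : seq gT).

Definition power_subgroup n (A : {set gT}) : {group gT} :=
  <<[set x ^+ n | x in A]>>%G.

Lemma power_subgroup_sub n G : power_subgroup n G \subset G.
Proof.
by rewrite gen_subG; apply/subsetP => _ /imsetP[x Gx ->]; apply: groupX.
Qed.

Lemma power_subgroupS n (A B : {set gT}) :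
  A \subset B -> power_subgroup n A \subset power_subgroup n B.
Proof. by move=> sAB; apply/genS/imsetS. Qed.

Lemma power_subgroup_gen n (B : {set gT}) :
  abelian <<B>> -> power_subgroup n <<B>> = power_subgroup n B :> {set gT}.
Proof.
move=> cBB.
have powM : {in <<B>> &, {morph (fun x => x ^+ n) : x y / x * y}}.
  by move=> x y Bx By; apply: expgMn; apply: (centsP cBB).
have := morphim_gen (Morphism powM) (subset_gen B).
rewrite !morphimEsub ?subset_gen //= => e.
by apply/eqP; rewrite eqEsubset gen_subG {1}e subxx genS ?imsetS ?subset_gen.
Qed.

Lemma power_subgroup_cycle n x :
  power_subgroup n <[x]> = <[x ^+ n]> :> {set gT}.
Proof. by rewrite power_subgroup_gen ?cycle_abelian //= imset_set1. Qed.

Lemma power_subgroup_dprod n K H G :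
    abelian G -> K \x H = G ->
  power_subgroup n K \x power_subgroup n H = power_subgroup n G.
Proof.
move=> cGG defG; have [_ defKH cKH tiKH] := dprodP defG.
have eG : <<K :|: H>> = G by rewrite -(dprodWY defG).
rewrite dprodEY.
- rewrite -[in RHS]eG power_subgroup_gen ?eG //=.
  by rewrite joing_idl joing_idr imsetU.
- exact: centSS (power_subgroup_sub _ _) (power_subgroup_sub _ _) cKH.
- by apply/trivgP; rewrite -tiKH setISS ?power_subgroup_sub.
Qed.

Lemma p_rank_cycle p x : prime p -> 'r_p(<[x]>) = (p %| #[x]).
Proof.
move=> p_pr; have := p_rank_le_rank p <[x]>; rewrite rank_cycle.
have := p_rank_gt0 p <[x]>; rewrite mem_primes p_pr order_gt0 /= => <-.
by case: ('r_p(_)) => // -[|r] //; case: (x != 1).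
Qed.

(** Taking n-th powers turns a decomposition into cycles of generators x into
    one into cycles of generators x ^+ n, and p-ranks add up. *)
Lemma p_rank_power_subgroup p n b G :
    prime p -> abelian G -> \big[dprod/1]_(x <- b) <[x]> = G ->
  'r_p(power_subgroup n G) = count (fun x => p %| #[x ^+ n]) b.
Proof.
move=> p_pr; elim: b G => [|x b IHb] G cGG.
  rewrite big_nil => <- /=; rewrite -cycle1 /= power_subgroup_cycle.
  by rewrite expg1n cycle1 p_rank1.
rewrite big_cons => defG; have [[_ H _ defH] _ _ _] := dprodP defG.
rewrite defH in defG.
have cHH : abelian H by apply: abelianS cGG; rewrite -(dprodW defG) mulG_subr.
rewrite -(p_rank_dprod p (power_subgroup_dprod n cGG defG)) (IHb _ cHH defH) /=.
by rewrite power_subgroup_cycle p_rank_cycle.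
Qed.

(** The orders of the members of a cyclic basis are the invariant factors of
    the group, from the largest one on, possibly followed by ones. *)
Definition cyclic_basis b (A : {set gT}) :=
  \big[dprod/1]_(x <- b) <[x]> = A /\
  sorted [rel m n | n %| m] [seq #[x] | x <- b].

(** Beyond the end of b the default value 1 has order 1, so that these orders
    continue the sequence of invariant factors by ones. *)
Lemma nth_order b i : nth 1%N [seq #[x] | x <- b] i = #[nth 1 b i].
Proof.
have [lt|ge] := ltnP i (size b); first by rewrite (nth_map 1).
by rewrite !nth_default ?size_map // order1.
Qed.

Lemma cyclic_basis_dvdn b G i j : cyclic_basis b G -> i <= j ->
  #[nth 1 b j] %| #[nth 1 b i].
Proof.
case=> _ sb leij; have [lt|ge] := ltnP j (size b); last first.
  by rewrite (nth_default 1 ge) order1 dvd1n.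
rewrite -!nth_order.
apply: (sorted_leq_nth _ _ 1%N sb); rewrite ?inE ?size_map //.
- by move=> m n p /= h1 h2; apply: dvdn_trans h2 h1.
- by move=> m /=.
- exact: leq_ltn_trans leij lt.
Qed.

(** This determines the orders in a cyclic basis from the group alone. Counting
    from 0, if the order of the i-th generator does not divide n, a prime
    divisor of the order of its n-th power divides the orders of the n-th powers
    of the first i + 1 generators, by the divisibility chain; otherwise the n-th
    powers of the i-th and all later generators are trivial. *)
Lemma rank_power_subgroup n b G i :
    abelian G -> cyclic_basis b G ->
  ('r(power_subgroup n G) <= i) = (#[nth 1 b i] %| n).
Proof.
move=> cGG bb; have [defG _] := bb.
apply/idP/idP=> [|dvd_n].
  apply: contraTT; rewrite order_dvdn -order_eq1 -ltnNge => neq1.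
  set p := pdiv #[nth 1 b i ^+ n].
  have p_pr : prime p
    by apply: pdiv_prime; have := order_gt0 (nth 1 b i ^+ n); lia.
  apply: leq_trans (p_rank_le_rank p _).
  rewrite (p_rank_power_subgroup n p_pr cGG defG).
  have lt_ib : i < size b.
    rewrite ltnNge; apply: contra neq1 => /(nth_default 1)->.
    by rewrite expg1n order1.
  rewrite -(cat_take_drop i.+1 b) count_cat; apply: leq_trans (leq_addr _ _).
  have /eqP -> :
      count (fun x => p %| #[x ^+ n]) (take i.+1 b) == size (take i.+1 b).
    rewrite -all_count; apply/(all_nthP 1) => j; rewrite size_takel // => lt_ji.
    rewrite nth_take //=; apply: (dvdn_trans (pdiv_dvd #[nth 1 b i ^+ n])).
    have := cyclic_basis_dvdn bb (lt_ji : j <= i) => dvd_ij.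
    rewrite order_dvdn -expgM -order_dvdn; apply: dvdn_trans dvd_ij _.
    by rewrite order_dvdn expgM expg_order.
  by rewrite size_takel.
have [p p_pr ->] := rank_witness (power_subgroup n G).
rewrite (p_rank_power_subgroup n p_pr cGG defG).
rewrite -(cat_take_drop i b) count_cat.
have -> : count (fun x => p %| #[x ^+ n]) (drop i b) = 0.
  apply/eqP; rewrite eqn0Ngt -has_count -all_predC.
  apply/(all_nthP 1) => j _ /=; rewrite nth_drop.
  have := dvdn_trans (cyclic_basis_dvdn bb (leq_addr j i)) dvd_n.
  rewrite order_dvdn => /eqP->; rewrite order1.
  by rewrite dvdn1 neq_ltn prime_gt1 ?orbT.
rewrite addn0 (leq_trans (count_size _ _)) // size_take; case: ifP => //; lia.
Qed.

(** Half of the interlacing: rank is monotone. *)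
Lemma cyclic_basis_sub bH bK H K i : abelian K -> H \subset K ->
    cyclic_basis bH H -> cyclic_basis bK K ->
  #[nth 1 bH i] %| #[nth 1 bK i].
Proof.
move=> cKK sHK basH basK.
rewrite -(rank_power_subgroup _ _ (abelianS sHK cKK) basH).
apply: leq_trans (rankS (power_subgroupS _ sHK)) _.
by rewrite (rank_power_subgroup _ _ cKK basK).
Qed.

Lemma rank_joing_cycle a H : abelian (<[a]> <*> H) ->
  'r(<[a]> <*> H) <= 'r(H).+1.
Proof.
move=> cKK; have cHH := abelianS (joing_subr _ _) cKK.
rewrite -!grank_abelian //=; have [B <- <-] := grank_witness H.
rewrite joing_idl joing_idr (leq_trans (grank_min _)) // cardsU1.
by case: (_ \notin _).
Qed.

(** The other half: one more generator raises the rank by at most one. *)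
Lemma cyclic_basis_joing bH bK a H i :
    let K := <[a]> <*> H in abelian K ->
    cyclic_basis bH H -> cyclic_basis bK K ->
  #[nth 1 bK i.+1] %| #[nth 1 bH i].
Proof.
move=> /= cKK basH basK; have cHH := abelianS (joing_subr _ _) cKK.
rewrite -(rank_power_subgroup _ _ cKK basK); set n := #[_].
have e : power_subgroup n (<[a]> <*> H) =
    <[a ^+ n]> <*> power_subgroup n H :> {set gT}.
  rewrite -power_subgroup_cycle /= joing_idl joing_idr.
  have /= -> := power_subgroup_gen n (cKK : abelian << <[a]> :|: H>>).
  by rewrite imsetU.
rewrite e (leq_trans (rank_joing_cycle _)) //.
  by rewrite -e (abelianS (power_subgroup_sub _ _) cKK).
by rewrite ltnS (rank_power_subgroup _ _ cHH basH).
Qed.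

Lemma big_orders (R : Type) (idx : R) (op : Monoid.law idx) (F : nat -> R) b N :
    size b <= N -> F 1%N = idx ->
  \big[op/idx]_(x <- b) F #[x] = \big[op/idx]_(0 <= i < N) F #[nth 1 b i].
Proof.
move=> leN F1; rewrite (big_cat_nat (leq0n _) leN) /= [X in op _ X]big_nat_cond.
rewrite [X in op _ X]big1 ?Monoid.mulm1 ?(big_nth 1) // => i.
by case/andP=> /andP[lei _] _; rewrite nth_default // order1.
Qed.

(** The step of the induction over a generating set: adjoining a generator a
    to H increases the claimed radius by at least what a costs. *)
Lemma leq_halves_index a bH bK H :
    let K := <[a]> <*> H in abelian K ->
    cyclic_basis bH H -> cyclic_basis bK K ->
  (#|K : H| %/ 2 + \sum_(x <- bH) #[x] %/ 2 <= \sum_(x <- bK) #[x] %/ 2)%N.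
Proof.
move=> /= cKK basH basK; have sHK := joing_subr <[a]> H.
set N := maxn (size bH) (size bK).
have [leH leK] : size bH <= N /\ size bK <= N by rewrite leq_maxl leq_maxr.
have hk i := cyclic_basis_sub i cKK sHK basH basK.
have kh i := dvdn_leq (order_gt0 _) (cyclic_basis_joing i cKK basH basK).
have [//|_] := @interlaced_halves N _ (fun i => #[nth 1 bK i]) _ hk kh.
rewrite !(@big_orders _ _ _ (fun m => m %/ 2)%N _ N) //.
suff -> : #|<[a]> <*> H : H| =
    (\prod_(0 <= i < N) (#[nth 1%g bK i] %/ #[nth 1%g bH i]))%N by [].
apply/eqP; rewrite -(eqn_pmul2l (cardG_gt0 H)) Lagrange //.
have cardE b (L : {group gT}) :
    cyclic_basis b L -> #|L| = (\prod_(x <- b) #[x])%N.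
  by case=> /bigdprod_card.
rewrite (cardE _ _ basH) (cardE _ (<[a]> <*> H)%G basK).
rewrite !(@big_orders _ _ _ id _ N) // -big_split /=.
by apply/eqP/eq_bigr => i _; rewrite muln_divA // mulKn.
Qed.

(** Since a ^+ n lies in H for n the index of H, exponents of a matter modulo n
    only, and every residue has a representative of absolute value at most
    n / 2. *)
Lemma joing_cycle_index a H K x :
    abelian K -> <[a]> <*> H = K -> x \in K ->
  exists j h,
    [/\ j <= #|K : H| %/ 2, h \in H & x = a ^+ j * h \/ x = a ^- j * h].
Proof.
move=> cKK defK; set n := #|K : H|.
have [Ka sHK] : a \in K /\ H \subset K.
  by rewrite -defK joing_subr -cycle_subG joing_subl.
have nHK : K \subset 'N(H) by apply: sub_abelian_norm cKK sHK.
have n_gt0 : 0 < n by apply: indexg_gt0.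
have Han : a ^+ n \in H.
  apply: coset_idr; first by rewrite groupX // (subsetP nHK).
  rewrite morphX ?(subsetP nHK) //= /n -card_quotient //.
  by rewrite expg_cardG ?mem_quotient.
move=> Kx; have: x \in <[a]> * H.
  by rewrite -norm_joinEl ?defK // (subset_trans _ nHK) ?cycle_subG.
case/mulsgP=> _ h /cycleP[k ->] Hh ->.
have Hanq : (a ^+ n) ^+ (k %/ n) * h \in H by apply: groupM (groupX _ Han) Hh.
have e : a ^+ k = a ^+ (k %% n) * (a ^+ n) ^+ (k %/ n).
  by rewrite -expgM -expgD addnC mulnC -divn_eq.
have lt_kn := ltn_pmod k n_gt0.
case: (leqP (k %% n) (n %/ 2)) => [le|gt].
  exists (k %% n), ((a ^+ n) ^+ (k %/ n) * h).
  by split; rewrite // e mulgA; left.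
exists (n - k %% n), (a ^+ n * ((a ^+ n) ^+ (k %/ n) * h)); split.
- by lia.
- by rewrite groupM.
right; rewrite e !mulgA; congr (_ * _ * _).
apply: (mulgI (a ^+ (n - k %% n))).
by rewrite mulgA mulgV mul1g -expgD subnK // ltnW.
Qed.

Lemma cyclic_basis_gen b G : cyclic_basis b G -> <<[set x in b]>> = G.
Proof.
case=> /bigdprodWY <- _; elim: b => [|x b IHb].
  by rewrite big_nil set_nil.
by rewrite big_cons set_cons -!joingE -joing_idl -joing_idr IHb joing_idr.
Qed.

End Power.

(** * Balls around 0 *)

Section Ball.
Local Open Scope ring_scope.
Import GRing.Theory FinRing.Theory.
Variables (G : finZmodType) (A : {set G}).
Implicit Types (x y a : G).

Lemma ball_natmul a j : a \in sym0 A -> a *+ j \in ball A j.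
Proof.
move=> Aa; apply/imsetP; exists [ffun=> a].
  by apply/ffun_onP => i; rewrite ffunE.
by under eq_bigr do rewrite ffunE; rewrite sumr_const card_ord.
Qed.

Lemma ballD x y r s :
  x \in ball A r -> y \in ball A s -> x + y \in ball A (r + s).
Proof.
case/imsetP=> u /ffun_onP Au -> /imsetP[v /ffun_onP Av ->].
apply/imsetP.
exists [ffun i => match split i with inl j => u j | inr k => v k end].
  by apply/ffun_onP => i; rewrite ffunE; case: (split i).
rewrite big_split_ord; congr (_ + _); apply: eq_bigr => i _; rewrite ffunE.
  by rewrite (unsplitK (inl i)).
by rewrite (unsplitK (inr i)).
Qed.

Lemma sub_ball r s : (r <= s)%N -> ball A r \subset ball A s.
Proof.
move=> le_rs; apply/subsetP => x Bx; rewrite -(subnKC le_rs) -[x]addr0.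
rewrite ballD // -(mul0rn _ (s - r)) ball_natmul // !inE eqxx.
by rewrite orbT.
Qed.

(** The subgroup generated by the tail of s has a cyclic basis of its own, for
    which the induction hypothesis holds; the orders in the two bases are
    compared by [leq_halves_index]. *)
Lemma gen_sub_ball (s : seq G) b :
    {subset s <= A} -> cyclic_basis b <<[set x in s]>>%g ->
  <<[set x in s]>>%g \subset ball A (\sum_(x <- b) #[x]%g %/ 2)%N.
Proof.
have cGG (H : {group G}) : abelian H.
  by apply/centsP => x _ y _; apply: addrC.
elim: s b => [|a s IHs] b sA.
  rewrite set_nil gen0 => _; apply/subsetP => x /set1P->.
  apply: (subsetP (sub_ball (leq0n _))); apply: (@ball_natmul 0%R 0%N).
  by rewrite !inE eqxx orbT.
have [bH defH typeH] := abelian_structure (cGG <<[set x in s]>>%G).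
have basH : cyclic_basis bH <<[set x in s]>>%g.
  by split; rewrite // typeH abelian_type_dvdn_sorted.
have -> : <<[set x in a :: s]>>%g = (<[a]> <*> <<[set x in s]>>)%g.
  by rewrite joing_idl joing_idr set_cons.
move=> basK; have cKK := cGG (<[a]> <*> <<[set x in s]>>)%G.
apply/subsetP => x /(joing_cycle_index cKK erefl)[j [h [le_j Hh def_x]]].
have Aa : a \in A by apply: sA; rewrite mem_head.
have sA' : {subset s <= A} by move=> y sy; apply: sA; rewrite inE sy orbT.
apply: (subsetP (sub_ball (leq_halves_index cKK basH basK))).
apply: (subsetP (sub_ball (leq_add le_j (leqnn _)))).
have Bh := subsetP (IHs _ sA' basH) _ Hh.
case: def_x => ->.
  by rewrite zmodMgE ballD // zmodXgE ball_natmul // !inE Aa orbT.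
rewrite zmodMgE ballD // zmodVgE zmodXgE -mulNrn ball_natmul // !inE.
by rewrite imset_f.
Qed.

Lemma ball_cyclic_basis b :
    <<A>>%g = [set: G] -> cyclic_basis b [set: G] ->
  ball A (\sum_(x <- b) #[x]%g %/ 2)%N = [set: G].
Proof.
move=> genA basA; have gE : <<[set x in enum A]>>%g = [set: G].
  by rewrite -genA; congr (<<_>>%g); apply/setP => x; rewrite inE mem_enum.
have sA : {subset enum A <= A} by move=> x; rewrite mem_enum.
have := @gen_sub_ball (enum A) b sA; rewrite gE => /(_ basA) sub.
by apply/eqP; rewrite eqEsubset subsetT.
Qed.

(** Length functions bound radii from below. *)
Lemma leq_ball (w : G -> nat) x r :
    w 0 = 0%N -> (forall y, w (- y)%R <= w y)%N ->
    (forall y z, w (y + z)%R <= w y + w z)%N -> {in A, forall y, w y <= 1}%N ->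
  x \in ball A r -> (w x <= r)%N.
Proof.
move=> w0 wN wD wA /imsetP[u /ffun_onP Au ->].
rewrite -[r in (_ <= r)%N]card_ord -sum1_card.
apply: (big_ind2 (fun y n => w y <= n)%N); first by rewrite w0.
  by move=> y n z p wy wz; apply: leq_trans (wD y z) (leq_add wy wz).
move=> i _; have := Au i; rewrite !inE.
case/orP=> [/orP[/imsetP[y Ay ->]|/eqP->]|/wA//].
  exact: leq_trans (wN y) (wA y Ay).
by rewrite w0.
Qed.

End Ball.

(** * The standard generators *)

Section ProductOfCyclicGroups.
Import GroupScope.

Lemma cyclic_basis_injm (aT rT : finGroupType) (D : {group aT})
    (f : {morphism D >-> rT}) b :
    'injm f -> cyclic_basis b D -> {subset b <= D} ->
  cyclic_basis (map f b) (f @* D).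
Proof.
move=> injf [defD sb] bD; split; last first.
  rewrite -map_comp (_ : map _ b = [seq #[x] | x <- b]) //.
  by apply/eq_in_map => x bx /=; rewrite order_injm // bD.
rewrite -(injm_bigdprod (subxx _) injf
  (defD : \big[dprod/1]_(x <- b) <[x]>%G = D)).
rewrite big_map; apply: eq_big_seq => x bx /=.
by rewrite morphim_cycle // bD.
Qed.

Variables (r : nat) (m : r.-tuple nat).
Local Notation D := {dffun forall i : 'I_r, 'Z_(tnth m i)}.
Hypothesis m_gt1 : forall i, 1 < tnth m i.

Definition unit_vec (i : 'I_r) : D := dfung1 (Zp1 : 'Z_(tnth m i)).

Lemma order_unit_vec i : #[unit_vec i] = tnth m i.
Proof.
by rewrite (order_injm (injm_dfung1 _ i)) ?inE // order_Zp1 Zp_cast.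
Qed.

(** Reversed, because the type lists the m_i in increasing order and a cyclic
    basis is decreasing. *)
Definition unit_vecs : seq D := rev [seq unit_vec i | i <- enum 'I_r].

Lemma order_unit_vecs : [seq #[e] | e <- unit_vecs] = rev m.
Proof.
rewrite map_rev -map_comp; congr (rev _).
by rewrite -[RHS]map_tnth_enum; apply: eq_map => i; apply: order_unit_vec.
Qed.

Lemma unit_vecs_basis : sorted dvdn m -> cyclic_basis unit_vecs [set: D].
Proof.
move=> sm; split; last first.
  by rewrite order_unit_vecs rev_sorted.
rewrite (perm_big _ (permEl (perm_rev _))) big_map big_enum /=.
have -> : [set: D] = setXn (fun i => [set: 'Z_(tnth m i)]).
  by apply/setP => x; rewrite inE; apply/esym/setXnP => i; rewrite inE.
rewrite -(setXn_dprod (fun i => [set: 'Z_(tnth m i)]%G)).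
apply: eq_bigr => i _; rewrite -morphim_dfung1 /unit_vec.
by rewrite -(morphim_cycle (dfung1_morphism _ i)) ?inE // -Zp_cycle.
Qed.

(** The distance from x to 0 around the cycle Z/(n+1). *)
Definition cyclic_norm n (x : 'I_n.+1) := minn x (n.+1 - x).

Definition product_norm (x : D) := \sum_i cyclic_norm (x i).

Lemma product_norm1 : product_norm 1 = 0.
Proof.
by rewrite /product_norm big1 // => i _; rewrite ffunE /cyclic_norm min0n.
Qed.

Lemma product_normV x : product_norm x^-1 <= product_norm x.
Proof.
apply: leq_sum => i _; rewrite ffunE; move: (x i).
move: (Zp_trunc _) => n y; rewrite /cyclic_norm /=; have := ltn_ord y.
have [->|y_gt0] := posnP y; first by rewrite subn0 modnn min0n.
by rewrite modn_small; lia.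
Qed.

Lemma product_normM x y :
  product_norm (x * y) <= product_norm x + product_norm y.
Proof.
rewrite -big_split; apply: leq_sum => i _; rewrite ffunE /=; move: (x i) (y i).
move: (Zp_trunc _) => n {}x {}y; rewrite /cyclic_norm /=.
have := ltn_ord x; have := ltn_ord y; case: (ltnP (x + y) n.+2) => lt ltx lty.
  by rewrite modn_small //; lia.
by rewrite -(subnK lt) modnDr modn_small; lia.
Qed.

Lemma product_norm_unit_vec i : product_norm (unit_vec i) <= 1.
Proof.
rewrite /product_norm (bigD1 i) //= big1 ?addn0 => [|j neq_ij].
  by rewrite dfung1_id /cyclic_norm /= modn_small // geq_minl.
by rewrite dfung1_dflt 1?eq_sym // /cyclic_norm min0n.
Qed.

(** A point with all coordinates as far from 0 as possible. *)
Definition antipode : D := [ffun i => inZp (tnth m i %/ 2)].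

Lemma product_norm_antipode :
  product_norm antipode = \sum_(i < r) tnth m i %/ 2.
Proof.
apply: eq_bigr => i _; rewrite ffunE /cyclic_norm /=.
by have gt1 := m_gt1 i; rewrite !Zp_cast // modn_small; lia.
Qed.

End ProductOfCyclicGroups.

(** * The diameter *)

Lemma omaxA : associative omax.
Proof. by move=> [x|] [y|] [z|] //=; rewrite maxnA. Qed.
Lemma omaxC : commutative omax.
Proof. by move=> [x|] [y|] //=; rewrite maxnC. Qed.
Lemma omax0 : left_id (Some 0) omax.
Proof. by move=> [x|] //=; rewrite max0n. Qed.
HB.instance Definition _ := Monoid.isComLaw.Build _ _ omax omaxA omaxC omax0.

Lemma diam_wrtP (G : finZmodType) (A : {set G}) d :
    covers A d -> exists k, [/\ diam_wrt A = Some k, k <= d & covers A k].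
Proof.
move=> covAd; rewrite /diam_wrt.
case: boolp.pselect => [ex|[]]; last by exists d.
by case: ex_minnP => k covAk mink; exists k; split; rewrite ?mink.
Qed.

Theorem theorem2p1 (G : finZmodType) (r : nat) (m : r.-tuple nat) :
  has_type G m -> diam G = Some (\sum_(i < r) tnth m i %/ 2)%N.
Proof.
case=> m_gt1 sm /isogP[f injf fG]; set T := (\sum_(i < r) _)%N.
pose g := invm_morphism injf; pose b := map g (unit_vecs m).
have bij_fg x : f (g x) = x by rewrite /= invmK // fG inE.
have basD := unit_vecs_basis m_gt1 sm.
have basG : cyclic_basis b [set: G].
  have basfG : cyclic_basis (unit_vecs m) (f @* [set: G])%g by rewrite fG.
  have := cyclic_basis_injm (injm_invm injf) basfG; rewrite im_invm.
  by apply=> x; rewrite /= fG inE.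
have sumT : (\sum_(x <- b) #[x]%g %/ 2)%N = T.
  rewrite -(big_map (fun x : G => #[x]%g) predT (fun n => n %/ 2)).
  have -> : [seq #[x]%g | x <- b] = rev m.
    rewrite -order_unit_vecs // -map_comp; apply: eq_map => x /=.
    by apply: (order_injm (injm_invm injf)); rewrite /= fG inE.
  by rewrite (perm_big _ (permEl (perm_rev _))) big_tuple.
have upper A : <<A>>%g == [set: G] -> covers A T.
  by move/eqP=> genA; rewrite /covers -sumT ball_cyclic_basis.
pose A0 := [set x in b]; have genA0 : <<A0>>%g == [set: G].
  exact/eqP/cyclic_basis_gen.
rewrite /diam (bigD1 A0) //=.
have [k [-> le_kT covk]] := diam_wrtP (upper A0 genA0).
have -> : k = T.
  (* The ball of radius k is everything, so it contains the antipode. *)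
  apply/eqP; rewrite eqn_leq le_kT /T -product_norm_antipode //.
  rewrite -(bij_fg (antipode m)).
  apply: (leq_ball (w := fun x => product_norm (f x)) (A := A0)).
  - by rewrite -[0%R]/1%g morph1 product_norm1.
  - by move=> y; rewrite -[(- y)%R]/(y^-1)%g morphV ?inE // product_normV.
  - by move=> y z; rewrite -[(y + z)%R]/(y * z)%g morphM ?inE // product_normM.
  - move=> y; rewrite inE => /mapP[e De ->]; rewrite bij_fg.
    by move: De; rewrite mem_rev => /mapP[i _ ->]; apply: product_norm_unit_vec.
  by rewrite (eqP covk) inE.
set others := \big[omax/Some 0]_(A | _) _.
have [l -> le_lT] : exists2 l, others = Some l & l <= T.
  apply: (big_ind (fun d => exists2 l, d = Some l & l <= T)).
  - by exists 0.
  - move=> _ _ [x -> lex] [y -> ley]; exists (maxn x y) => //.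
    by rewrite geq_max lex.
  - by move=> A /andP[/upper/diam_wrtP[l [-> ? _]] _]; exists l.
by rewrite /= (maxn_idPl le_lT).
Qed.
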